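(* Let $\{\varphi_r\}_{0<r<1}$ be a family of nonnegative functions on $\mathbb{T}$ such that (i) $\int_{\mathbb{T}}\varphi_r(t)\,dt=1$ for all $0<r<1$; and (ii) for any numbers $\varepsilon>0$ and $0<\tau<1$ there exists $\delta>0$ such that $\int_e\varphi_r(t)\,dt<\varepsilon$ for all $0<r<\tau$ and every measurable set $e\subset\mathbb{T}$ with $|e|<\delta$. Let $\lambda\in C[0,1]$ be a real-valued function satisfying $$\lambda(1)=0,\qquad \beta:=\limsup_{\delta\to 0}\ \liminf_{r\to 1}\int_{-\delta\lambda(r)}^{\delta\lambda(r)}\varphi_r(t)\,dt>\frac12 .$$ Then there exists a measurable set $E\subset\mathbb{T}$ such that for every $x\in\mathbb{T}$ $$\limsup_{r\to 1}\Phi_r\bigl(x+\lambda(r),\mathbb{I}_E\bigr)-\liminf_{r\to 1}\Phi_r\bigl(x+\lambda(r),\mathbb{I}_E\bigr)\ge 2\beta-1 .$$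
   Context: $\mathbb{T}=\mathbb{R}/2\pi\mathbb{Z}$ is equipped with Lebesgue measure $dt$ (total mass $2\pi$), $|e|$ is the Lebesgue measure of $e$, and functions on $\mathbb{T}$ are regarded as $2\pi$-periodic functions on $\mathbb{R}$. For $f\in L^\infty(\mathbb{T})$ and $0<r<1$, $\Phi_r(x,f)=\int_{\mathbb{T}}\varphi_r(x-t)f(t)\,dt$. $\mathbb{I}_E$ is the indicator function of $E$. Limits $r\to1$ are taken over $r<1$, and $\delta\to0$ over $\delta>0$. The integral $\int_a^b$ is the usual oriented integral. *)

(* Defs.v *)
From HB Require Import structures.
From mathcomp Require Import all_boot all_order all_algebra.
From mathcomp Require Import all_classical all_reals all_analysis.

Set Implicit Arguments.
Unset Strict Implicit.
Unset Printing Implicit Defensive.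

Import Order.TTheory GRing.Theory Num.Theory.
Import numFieldNormedType.Exports.

Local Open Scope classical_set_scope.
Local Open Scope ring_scope.

(* The carrier R with the sigma-algebra of all Lebesgue measurable sets; the
   default sigma-algebra of R in MathComp-Analysis is the Borel one. *)
Notation lebesgueR R := (caratheodory_type (@wlength R idfun)^*%mu).

Definition leb (R : realType) : {measure set (lebesgueR R) -> \bar R} :=
  @completed_lebesgue_measure R.

Section Torus.
Context {R : realType}.
Implicit Types (E : set R) (f g : R -> R).

(* Functions on R / 2 pi Z are 2 pi-periodic functions on R, and subsets of
   R / 2 pi Z are 2 pi-periodic subsets of R; measures and integrals over
   R / 2 pi Z are computed on the fundamental domain [0, 2 pi[. *)
Definition torus_dom : set R := `[0, pi *+ 2[%classic.

Definition torus_measurable E :=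
  measurable (E : set (lebesgueR R)) /\
  (forall x : R, E (x + pi *+ 2) <-> E x).

Definition torus_measurable_fun f :=
  measurable_fun [set: lebesgueR R] (f : lebesgueR R -> R) /\
  periodic f (pi *+ 2).

Definition torus_measure E : \bar R := leb R (E `&` torus_dom).

Definition torus_integral E f : \bar R :=
  (\int[leb R]_(t in E `&` torus_dom) (f t)%:E)%E.

Definition oriented_integral (a b : R) f : \bar R :=
  if a <= b then (\int[leb R]_(t in `[a, b]) (f t)%:E)%E
  else (- \int[leb R]_(t in `[b, a]) (f t)%:E)%E.

Definition Phi (phi : R -> R -> R) (r x : R) f : \bar R :=
  torus_integral setT (fun t => phi r (x - t) * f t).

End Torus.

(* Main.v *)
(** The concentration hypothesis says that, for every [delta > 0], the kernel
[phi r] carries mass at least [beta - o(1)] on the interval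
[[- delta lam(r), delta lam(r)]] as [r] tends to 1.  Let [M] be the
[2 delta u]-neighbourhood of the grid [u Z], where [2 pi / u] is an integer.
Every [x] has a grid point [y] in [x + u, x + 2u], and since [lam] is continuous
and tends to 0 there is [r] with [x + lam(r) = y]; the interval of radius
[delta lam(r)] around [y] lies in [M], so [Phi r (x + lam(r)) 1_M] is at least
[beta - o(1)].  The relative measure of [M] depends on [delta] only, and the [r]
that occur stay below some [tau < 1], so by equi-integrability this bound
survives the removal from [M] of any set of sufficiently small measure.  Now
choose such sets [M_0, M_1, ...] whose measures decrease fast enough, and let
[E] consist of the points for which the last [M_k] containing them has even
index: stages of even index give a limsup of at least [beta], and stages of odd
index, applied to the complement of [E], a liminf of at most [1 - beta]. *)

Require Import Defs.
From mathcomp Require Import all_boot all_order all_algebra.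
From mathcomp Require Import all_classical all_reals all_analysis.
From mathcomp Require Import measurable_realfun ring lra.

Set Implicit Arguments.
Unset Strict Implicit.
Unset Printing Implicit Defensive.

Import Order.TTheory GRing.Theory Num.Theory.
Import numFieldNormedType.Exports.

Local Open Scope classical_set_scope.
Local Open Scope ring_scope.

(** * Reflection and periodicity for the completed Lebesgue measure *)

Lemma ge0_integral_measure_preserving d (T : measurableType d) (R : realType)
    (mu : {measure set T -> \bar R}) (tau : T -> T) (D : set T)
    (f : T -> \bar R) :
  measurable_fun [set: T] tau ->
  (forall A, measurable A -> mu (tau @^-1` A) = mu A) ->
  measurable D -> measurable_fun D f -> (forall t, D t -> 0 <= f t)%E ->
  (\int[mu]_(t in D) f t = \int[mu]_(t in tau @^-1` D) f (tau t))%E.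
Proof.
move=> mtau mutau mD mf f0.
rewrite -(ge0_integral_pushforward mtau)//; last first.
  by move=> t /set_mem; exact: f0.
by apply: eq_measure_integral => A mA _; rewrite -(mutau A mA).
Qed.

Lemma leb_borel_measurable (R : realType) (A : set (measurableTypeR R)) :
  measurable A -> measurable (A : set (lebesgueR R)).
Proof. by move=> mA; apply: sub_caratheodory. Qed.

Lemma leb_itv_measurable (R : realType) (i : interval R) :
  measurable ([set` i] : set (lebesgueR R)).
Proof. by apply: leb_borel_measurable; exact: measurable_itv. Qed.

(** One outer measure underlies the Borel measure and its completion, so this holds by computation,
    for nonmeasurable sets too. *)
Lemma leb_lebesgue (R : realType) (A : set R) : leb R A = lebesgue_measure A.
Proof. by []. Qed.

Lemma leb_set1 (R : realType) (a : R) : leb R [set a] = 0%E.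
Proof. by rewrite leb_lebesgue lebesgue_measure_set1. Qed.

(** A Borel measure giving each []a, b]] its length is Lebesgue measure, and the reflected interval
    [[y - b, y - a[] has the same length. *)
Lemma lebesgue_measure_reflect (R : realType) (y : R) (A : set R) :
  measurable A ->
  pushforward lebesgue_measure ((fun t : R => y - t) : _ -> measurableTypeR R) A
  = lebesgue_measure A.
Proof.
move=> mA; apply/esym/lebesgue_measure_unique => //=.
  by apply: continuous_measurable_fun => t;
    apply: cvgB; [exact: cvg_cst|exact: cvg_id].
move=> ? _ [[a b]] _ <-; rewrite /pushforward.
rewrite [X in _ = lebesgue_measure X](_ : _ = `[y - b, y - a[%classic);
    last first.
  by apply/seteqP; split => t /=; rewrite !in_itv/= => /andP[? ?];
    apply/andP; split; lra.
rewrite /= !lebesgue_measure_itv/= !lte_fin ltrD2l ltrN2.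
by case: ifP => //= _; rewrite -!EFinB; congr EFin; ring.
Qed.

Section reflection.
Context (R : realType) (y : R).
Local Notation tau := (fun t : R => y - t).
Let tauK : involutive tau. Proof. by move=> t; rewrite subKr. Qed.

(* Outer regularity reduces the inequality to open sets, where the uniqueness of
   the Borel measure applies; the converse holds because [tau] is involutive. *)
Lemma leb_reflect (A : set R) : leb R (tau @^-1` A) = leb R A.
Proof.
suff H B : (leb R (tau @^-1` B) <= leb R B)%E.
  apply/eqP; rewrite eq_le H/=.
  rewrite [X in (leb R X <= _)%E](_ : _ = tau @^-1` (tau @^-1` A)) ?H//.
  by apply/seteqP; split => t /=; rewrite tauK.
rewrite [leRHS](outer_measure_open B).
apply: le_ereal_inf_tmp => _ [U [oU BU] <-].
have H := @lebesgue_measure_reflect R y U (open_measurable oU).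
apply: (@le_trans _ _ (leb R (tau @^-1` U))).
  by apply: le_outer_measure => t; exact: BU.
by rewrite le_eqVlt; apply/orP; left; apply/eqP; exact: H.
Qed.

Lemma leb_measurableE (A : set R) : measurable (A : set (lebesgueR R)) =
  (forall X : set R, leb R X = leb R (X `&` A) + leb R (X `&` ~` A))%E.
Proof. by []. Qed.

(** Caratheodory's criterion involves only outer measures of arbitrary sets, and [leb_reflect]
    covers all of these. *)
Lemma measurable_reflect :
  measurable_fun [set: lebesgueR R] (tau : lebesgueR R -> lebesgueR R).
Proof.
move=> _ A; rewrite setTI !leb_measurableE => mA X.
rewrite -leb_reflect mA -(leb_reflect (X `&` _)) -(leb_reflect (X `&` ~` _)).
by congr (leb R _ + leb R _)%E; apply/seteqP; split => t /=; rewrite subKr.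
Qed.

Lemma ge0_integral_reflect (D : set (lebesgueR R)) (f : lebesgueR R -> \bar R) :
  measurable D -> measurable_fun D f -> (forall t, D t -> 0 <= f t)%E ->
  (\int[leb R]_(t in D) f t = \int[leb R]_(t in tau @^-1` D) f (y - t)%R)%E.
Proof.
move=> mD mf f0.
exact: (@ge0_integral_measure_preserving _ (lebesgueR R) R (leb R) _ D f
  measurable_reflect (fun A _ => leb_reflect A)).
Qed.

End reflection.


Section translation.
Context (R : realType).
Implicit Types f : lebesgueR R -> \bar R.

(** Translation by [c] is the composite of the reflections [t -> - t] and [t -> c - t]. *)
Lemma ge0_integral_translate (c : R) (D : set (lebesgueR R)) f :
  measurable D -> measurable_fun D f -> (forall t, D t -> 0 <= f t)%E ->
  (\int[leb R]_(t in D) f t =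
   \int[leb R]_(t in (fun t : R => t + c)%R @^-1` D) f (t + c)%R)%E.
Proof.
move=> mD mf f0; rewrite (@ge0_integral_reflect R c)//.
rewrite (@ge0_integral_reflect R 0).
- rewrite (_ : _ @^-1` (_ @^-1` D) = (fun t : R => t + c)%R @^-1` D).
    by apply: eq_integral => t _; congr f; rewrite sub0r opprK addrC.
  by apply/seteqP; split => t /=; rewrite sub0r opprK addrC.
- by rewrite -[X in measurable X]setTI; exact: measurable_reflect.
- apply: (measurable_comp mD) => //; first by move=> _ [t Dt <-].
  exact/measurable_funTS/measurable_reflect.
- by move=> t; exact: f0.
Qed.

Section periodic.
Context (f : lebesgueR R -> \bar R) (T : R).
Hypothesis T0 : 0 < T.
Hypothesis mf : measurable_fun setT f.
Hypothesis f0 : forall t, (0 <= f t)%E.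
Hypothesis fT : forall t : R, f (t + T)%R = f t.

Lemma ge0_integral_itv_split (a b c : R) : a <= b -> b <= c ->
  (\int[leb R]_(t in `[a, c[) f t =
   \int[leb R]_(t in `[a, b[) f t + \int[leb R]_(t in `[b, c[) f t)%E.
Proof.
move=> ab bc; rewrite -ge0_integral_setU//.
- congr integral; apply/seteqP; split => t /=; rewrite !in_itv/=.
    by move=> /andP[-> ->]; rewrite andbT/=; case: (ltP t b); [left|right].
  move=> [|] /andP[? ?]; apply/andP; split; lra.
- exact: leb_itv_measurable.
- exact: leb_itv_measurable.
- exact: measurable_funTS.
- apply/disj_setPS => t /= [].
  by rewrite !in_itv/= => /andP[_ ?] /andP[? _]; lra.
Qed.

(** Both periods contain [[b, a + T[], and translation by [T] carries the remaining [[a, b[] onto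
    [[a + T, b + T[]. *)
Lemma integral_period_step (a b : R) : a <= b <= a + T ->
  (\int[leb R]_(t in `[a, (a + T)%R[) f t =
   \int[leb R]_(t in `[b, (b + T)%R[) f t)%E.
Proof.
move=> /andP[ab baT].
rewrite (@ge0_integral_itv_split a b (a + T))//.
rewrite (@ge0_integral_itv_split b (a + T) (b + T))// ?lerD2r// addeC.
congr (_ + _)%E.
rewrite [RHS](@ge0_integral_translate T)//; last 2 first.
- exact: leb_itv_measurable.
- exact: measurable_funTS.
rewrite (_ : _ @^-1` _ = `[a, b[%classic).
  by apply: eq_integral => t _; rewrite fT.
by apply/seteqP; split => t /=; rewrite !in_itv/= lerD2r ltrD2r.
Qed.

Lemma integral_period (a : R) :
  (\int[leb R]_(t in `[a, (a + T)%R[) f t = \int[leb R]_(t in `[0%R, T[) f t)%E.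
Proof.
have H (n : nat) b :
    (\int[leb R]_(t in `[(b + T *+ n)%R, (b + T *+ n + T)%R[) f t =
     \int[leb R]_(t in `[b, (b + T)%R[) f t)%E.
  elim: n => [|n IH]; first by rewrite mulr0n addr0.
  rewrite -IH; apply/esym/integral_period_step.
  by rewrite mulrSr addrA lexx andbT -[leLHS]addr0 lerD2l ltW.
have Hpos b : 0 <= b -> (\int[leb R]_(t in `[b, (b + T)%R[) f t =
                         \int[leb R]_(t in `[0%R, T[) f t)%E.
  move=> b0.
  pose n := Num.truncn (b / T).
  have bT0 : 0 <= b / T by rewrite divr_ge0// ltW.
  have nb : T *+ n <= b.
    by rewrite -mulr_natl -ler_pdivlMr//; have /andP[] := truncn_itv bT0.
  have bn : b <= T *+ n + T.
    rewrite -mulrSr -mulr_natl -ler_pdivrMr//; apply/ltW.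
    by have /andP[] := truncn_itv bT0.
  rewrite -[b in LHS](subrK (T *+ n)) (H n (b - T *+ n)).
  rewrite -(@integral_period_step 0); last by rewrite add0r subr_ge0 nb lerBlDl.
  by rewrite add0r.
(* Moving [a] up by this many periods makes it nonnegative. *)
pose n := (Num.truncn (`|a| / T)).+1.
rewrite -(H n a); apply: Hpos.
rewrite -lerBlDl sub0r (le_trans (ler_norm _))// normrN.
rewrite -mulr_natl -ler_pdivrMr//.
by apply/ltW/truncnS_gt.
Qed.

End periodic.
End translation.

(** * Integration on the torus *)

Section torus.
Context {R : realType}.
Implicit Types (f g : R -> R) (E N : set R).

Lemma measurable_torus_dom : measurable (torus_dom : set (lebesgueR R)).
Proof. exact: leb_itv_measurable. Qed.

(** Reflection turns [[0, 2 pi[] into []y - 2 pi, y]], which differs from the period [[y - 2 pi, y[]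
    only by two endpoints of measure zero. *)
Lemma torus_integral_reflect (y : R) f :
  torus_measurable_fun f -> (forall t, 0 <= f t) ->
  torus_integral setT (fun t => f (y - t)) = torus_integral setT f.
Proof.
move=> [mf pf] f0.
rewrite /torus_integral setTI.
have mEf : measurable_fun [set: lebesgueR R]
    (fun t : lebesgueR R => (f t)%:E) by exact/measurable_EFinP.
rewrite -(@integral_period R (fun t => (f t)%:E) (pi *+ 2) _ mEf _ _
  (y - pi *+ 2)); last 3 first.
- by rewrite mulrn_wgt0 ?pi_gt0.
- by move=> t; rewrite lee_fin.
- by move=> t; rewrite pf.
rewrite subrK.
have T0 : 0 < pi *+ 2 :> R by rewrite mulrn_wgt0 ?pi_gt0.
transitivity (\int[leb R]_(t in `](y - pi *+ 2)%R, y]) (f t)%:E)%E.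
  rewrite [RHS](@ge0_integral_reflect R y); last 3 first.
  - exact: leb_itv_measurable.
  - exact: measurable_funTS.
  - by move=> t _; rewrite lee_fin.
  rewrite /torus_dom; congr integral; apply/seteqP.
  by split => t /=; rewrite !in_itv/= => /andP[? ?]; apply/andP; split; lra.
rewrite (@ge0_negligible_integral _ _ _ (leb R) _ [set y]); last 5 first.
- by apply: leb_borel_measurable; exact: measurable_set1.
- exact: leb_itv_measurable.
- exact: measurable_funTS.
- by move=> t _; rewrite lee_fin.
- exact: leb_set1.
rewrite [RHS](@ge0_negligible_integral _ _ _ (leb R) _ [set y - pi *+ 2]);
  last 5 first.
- by apply: leb_borel_measurable; exact: measurable_set1.
- exact: leb_itv_measurable.
- exact: measurable_funTS.
- by move=> t _; rewrite lee_fin.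
- exact: leb_set1.
congr integral; apply/seteqP.
split => t /=; rewrite !in_itv/= => -[/andP[? ?] /eqP ?].
  by split; [apply/andP; split; lra|apply/eqP; lra].
split; [apply/andP; split; lra|apply/eqP; lra].
Qed.

(** By periodicity the full integral can be taken over [[- pi, pi[], which contains [[- c, c]]. *)
Lemma torus_integral_ge_itv (c : R) f :
  torus_measurable_fun f -> (forall t, 0 <= f t) -> c < pi ->
  (\int[leb R]_(t in `[(- c)%R, c]) (f t)%:E <= torus_integral setT f)%E.
Proof.
move=> [mf pf] f0 cpi; rewrite /torus_integral setTI.
have mEf : measurable_fun [set: lebesgueR R]
    (fun t : lebesgueR R => (f t)%:E) by exact/measurable_EFinP.
rewrite -(@integral_period R (fun t => (f t)%:E) (pi *+ 2) _ mEf _ _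
  (- pi)); last 3 first.
- by rewrite mulrn_wgt0 ?pi_gt0.
- by move=> t; rewrite lee_fin.
- by move=> t; rewrite pf.
apply: ge0_subset_integral.
- exact: leb_itv_measurable.
- exact: leb_itv_measurable.
- exact: measurable_funTS.
- by move=> t _; rewrite lee_fin.
by move=> t /=; rewrite !in_itv/= mulr2n => /andP[? ?]; apply/andP; split; lra.
Qed.

Lemma torus_measurableC E : torus_measurable E -> torus_measurable (~` E).
Proof.
move=> [mE pE]; split; first exact: measurableC.
by move=> x; split => + /pE.
Qed.

Lemma torus_measurable_bigcup (F : nat -> set R) :
  (forall k, torus_measurable (F k)) -> torus_measurable (\bigcup_k F k).
Proof.
move=> mF; split; first by apply: bigcupT_measurable => k; case: (mF k).
by move=> x; split => -[k _ /(mF k).2 Fx]; exists k.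
Qed.

Lemma torus_measurableD E N :
  torus_measurable E -> torus_measurable N -> torus_measurable (E `\` N).
Proof.
move=> [mE pE] [mN pN]; split; first exact: measurableD.
by move=> x; split => -[/pE Ex nNx]; split => // /pN.
Qed.

Lemma torus_measurable_funM f g :
  torus_measurable_fun f -> torus_measurable_fun g ->
  torus_measurable_fun (fun t => f t * g t).
Proof.
move=> [mf pf] [mg pg]; split; first exact: measurable_funM.
by move=> t; rewrite pf pg.
Qed.

Lemma torus_measurable_funD f g :
  torus_measurable_fun f -> torus_measurable_fun g ->
  torus_measurable_fun (fun t => f t + g t).
Proof.
move=> [mf pf] [mg pg]; split; first exact: measurable_funD.
by move=> t; rewrite pf pg.
Qed.

Lemma torus_measurable_fun_indic E :
  torus_measurable E -> torus_measurable_fun (\1_E).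
Proof.
move=> [mE pE]; split; first exact: measurable_indic.
move=> t; rewrite !indicE; congr (nat_of_bool _)%:R.
by apply/idP/idP; rewrite !inE => /pE.
Qed.

Lemma torus_measurable_fun_reflect (y : R) f :
  torus_measurable_fun f -> torus_measurable_fun (fun t => f (y - t)).
Proof.
move=> [mf pf]; split.
  exact: (measurableT_comp mf (@measurable_reflect R y)).
by move=> t; rewrite -[LHS]pf; congr f; ring.
Qed.

Lemma torus_measurable_reflect (y : R) E :
  torus_measurable E -> torus_measurable (fun t => E (y - t)).
Proof.
move=> [mE pE]; split.
  by rewrite -[X in measurable X]setTI; exact: (@measurable_reflect R y).
by move=> t; rewrite -pE (_ : _ + _ = y - t)//; ring.
Qed.

Lemma torus_integral_indicE E f :
  torus_integral E f = torus_integral setT (fun t => f t * \1_E t).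
Proof.
rewrite /torus_integral setTI setIC integral_mkcondr.
by apply: eq_integral => t _; rewrite epatch_indic /= EFinM.
Qed.

Lemma torus_measureE E :
  torus_measurable E -> torus_measure E = torus_integral setT (\1_E).
Proof.
move=> [mE _]; rewrite /torus_integral setTI integral_indic//.
exact: measurable_torus_dom.
Qed.

Lemma torus_measure_reflect (y : R) E : torus_measurable E ->
  torus_measure (fun t => E (y - t)) = torus_measure E.
Proof.
move=> mE; rewrite !torus_measureE//; last exact: torus_measurable_reflect.
by rewrite -(@torus_integral_reflect y \1_E)//;
  exact: torus_measurable_fun_indic.
Qed.

Lemma torus_integralD f g :
  torus_measurable_fun f -> torus_measurable_fun g ->
  (forall t, 0 <= f t) -> (forall t, 0 <= g t) ->
  torus_integral setT (fun t => f t + g t) =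
  (torus_integral setT f + torus_integral setT g)%E.
Proof.
move=> [mf _] [mg _] f0 g0; rewrite /torus_integral !setTI.
rewrite -ge0_integralD//.
- exact: measurable_torus_dom.
- by move=> t _; rewrite lee_fin.
- by apply/measurable_EFinP; exact: measurable_funTS.
- by move=> t _; rewrite lee_fin.
- by apply/measurable_EFinP; exact: measurable_funTS.
Qed.

(** * The averages [Phi] of indicator functions *)

Section Phi.
Context (phi : R -> R -> R) (r : R).
Hypothesis mphi : torus_measurable_fun (phi r).
Hypothesis phi0 : forall t, 0 <= phi r t.

(** The substitution [s = y - t] centres the kernel at the origin, where its concentration is
    known. *)
Lemma PhiE (y : R) f : torus_measurable_fun f -> (forall t, 0 <= f t) ->
  Phi phi r y f = torus_integral setT (fun s => phi r s * f (y - s)).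
Proof.
move=> mf f0; rewrite /Phi -[RHS](torus_integral_reflect y).
- congr torus_integral; apply/funext => t; congr (_ * f _); ring.
- by apply: torus_measurable_funM => //; exact: torus_measurable_fun_reflect.
- by move=> t; rewrite mulr_ge0.
Qed.

Lemma Phi_ge0 (y : R) E : (0 <= Phi phi r y \1_E)%E.
Proof. by apply: integral_ge0 => t _; rewrite lee_fin mulr_ge0. Qed.

(** The two indicators sum to 1, so a lower bound for the complement becomes an upper bound for
    [E]. *)
Lemma Phi_compl (y : R) E : torus_measurable E ->
  (Phi phi r y \1_E + Phi phi r y \1_(~` E))%E = torus_integral setT (phi r).
Proof.
move=> mE.
rewrite /Phi -torus_integralD.
- rewrite -[RHS](torus_integral_reflect y mphi phi0).
  congr torus_integral; apply/funext => t.
  by rewrite -mulrDr indicC/= indicE;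
    case: (t \in E); rewrite ?addr0 ?add0r mulr1.
- apply: torus_measurable_funM; last exact: torus_measurable_fun_indic.
  exact: torus_measurable_fun_reflect.
- apply: torus_measurable_funM; first exact: torus_measurable_fun_reflect.
  exact/torus_measurable_fun_indic/torus_measurableC.
- by move=> t; rewrite mulr_ge0.
- by move=> t; rewrite mulr_ge0.
Qed.

(** For [s] in [[- c, c]] the point [y - s] lies in [E] or in [N], so [phi r] is dominated there by
    its product with the sum of the two reflected indicators. The loss due to [N] is the kernel mass
    of its reflection. *)
Lemma Phi_lower (y c : R) E N :
  torus_measurable E -> torus_measurable N -> c < pi ->
  (forall t, y - c <= t <= y + c -> E t \/ N t) ->
  (\int[leb R]_(t in `[(- c)%R, c]) (phi r t)%:E <=
   Phi phi r y \1_E + torus_integral (fun s => N (y - s)%R) (phi r))%E.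
Proof.
move=> mE mN cpi cov.
have mE' := torus_measurable_fun_reflect y (torus_measurable_fun_indic mE).
have mN' := torus_measurable_fun_indic (torus_measurable_reflect y mN).
rewrite PhiE//; last exact: torus_measurable_fun_indic.
rewrite (torus_integral_indicE (fun s => N (y - s))).
rewrite -torus_integralD; last 4 first.
- exact: torus_measurable_funM.
- exact: torus_measurable_funM.
- by move=> t; rewrite mulr_ge0.
- by move=> t; rewrite mulr_ge0.
set g := fun t : R => _ + _.
have mg : torus_measurable_fun g.
  by apply: torus_measurable_funD; exact: torus_measurable_funM.
have g0 t : 0 <= g t by rewrite addr_ge0// mulr_ge0.
apply: le_trans (torus_integral_ge_itv mg g0 cpi).
apply: ge0_le_integral => //=.
- exact: leb_itv_measurable.
- by move=> t _; rewrite lee_fin.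
- by apply/measurable_EFinP; apply: measurable_funTS; exact: mphi.1.
- by apply/measurable_EFinP; apply: measurable_funTS; exact: mg.1.
move=> t; rewrite in_itv/= lee_fin => /andP[tc ct].
rewrite /g -mulrDr ler_peMr// !indicE.
have [Et|Nt] : E (y - t) \/ N (y - t) by apply: cov; apply/andP; split; lra.
- by rewrite (mem_set Et) lerDl.
- by rewrite (@mem_set _ (fun s => N (y - s)) t Nt) lerDr.
Qed.

End Phi.
End torus.

(** * Concentration of the kernel *)

Lemma at_left_itv (R : realType) (x : R) (V : set R) : x^'- V ->
  exists2 e : R, 0 < e & forall t, x - e < t < x -> V t.
Proof.
move=> /nbhs_ballP[e /= e0 H]; exists e => // t /andP[t1 t2].
by apply: H => //=; rewrite /ball/= ltr_distl; lra.
Qed.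

Lemma limf_einf_gt (R : realType) (f : R -> \bar R) (x : R) (a : \bar R) :
  (a < limf_einf f x^'-)%E ->
  exists2 e : R, 0 < e & forall t, x - e < t < x -> (a < f t)%E.
Proof.
rewrite limf_einfE => /ereal_sup_gt[_ [V FV <-] aV].
have [e e0 H] := at_left_itv FV.
exists e => // t /H Vt.
by apply: lt_le_trans aV _; apply: ereal_inf_lbound; exists t.
Qed.

(** The same [e] bounds the distance to [x] and the loss in the value; it is applied to the minimum
    of the required loss and the radius of the neighbourhood. *)
Lemma limf_esup_ge (R : realType) (f : R -> \bar R) (x a : R) :
  (forall e, 0 < e -> exists2 t, x - e < t < x & ((a - e)%:E <= f t)%E) ->
  (a%:E <= limf_esup f x^'-)%E.
Proof.
move=> H; apply: le_ereal_inf_tmp => _ [V FV <-].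
have [e0 e00 HV] := at_left_itv FV.
apply/lee_subgt0Pr => e e1.
have [|t tx ft] := H (Num.min e0 e); first by rewrite lt_min e00.
apply: le_ereal_sup_tmp; exists (f t).
  exists t => //; apply: HV; move: tx => /andP[tx ->]; rewrite andbT.
  by apply: le_lt_trans tx; rewrite lerD2l lerN2 ge_min lexx.
by apply: le_trans ft; rewrite -EFinB lee_fin lerD2l lerN2 ge_min lexx orbT.
Qed.

Section kernel.
Context (R : realType) (phi : R -> R -> R) (lam : R -> R) (beta : \bar R).
Hypotheses
    (phi_fun : forall r : R, 0 < r < 1 -> torus_measurable_fun (phi r))
    (phi_ge0 : forall r : R, 0 < r < 1 -> forall t, 0 <= phi r t)
    (phi_int1 : forall r : R, 0 < r < 1 -> torus_integral setT (phi r) = 1%E)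
    (lam_cont : {within `[0, 1]%classic, continuous lam})
    (lam1 : lam 1 = 0)
    (beta_def : beta = limf_esup (fun delta : R =>
       limf_einf (fun r : R =>
         oriented_integral (- (delta * lam r)) (delta * lam r) (phi r))
         1^'-) 0^'+)
    (beta_gt : ((2^-1)%:E < beta)%E).
Local Notation G d r := (oriented_integral (- (d * lam r)) (d * lam r) (phi r)).

(** The limsup is an infimum over neighbourhoods, so the supremum of the inner liminf over []0, d[]
    still exceeds [a]. *)
Lemma oriented_gt (a d : R) : (a%:E < beta)%E -> 0 < d ->
  exists2 d' : R, 0 < d' < d & exists2 e : R, 0 < e &
    forall r : R, 1 - e < r < 1 -> (a%:E < G d' r)%E.
Proof.
move=> ab d0.
have [|_ [d' /= d'0 <-] ad'] := @ereal_sup_gt R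
  ((fun delta => limf_einf (fun r => G delta r) 1^'-) @` `]0, d[) a%:E.
  apply: lt_le_trans ab _; rewrite beta_def; apply: ereal_inf_lbound.
  exists `]0, d[%classic => //.
  by near=> t; rewrite /= in_itv/=; apply/andP; split; near: t;
    [exact: nbhs_right_gt|exact: nbhs_right_lt].
exists d'; first by rewrite in_itv in d'0.
exact: limf_einf_gt ad'.
Unshelve. all: by end_near. Qed.

Lemma oriented_le0 (c : R) (f : R -> R) : torus_measurable_fun f ->
  (forall t, 0 <= f t) -> c <= 0 -> (oriented_integral (- c) c f <= 0)%E.
Proof.
move=> [mf _] f0; rewrite le_eqVlt => /orP[/eqP ->|c0].
  rewrite /oriented_integral oppr0 lexx set_itv1 null_set_integral//.
  - by apply: leb_borel_measurable; exact: measurable_set1.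
  - by apply/measurable_EFinP; exact: measurable_funTS.
  - exact: leb_set1.
rewrite /oriented_integral ifF; last by apply/negbTE; rewrite -ltNge; lra.
by rewrite leeNl oppe0 integral_ge0// => t _; rewrite lee_fin.
Qed.

(* Where [lam r <= 0], the oriented integral cannot exceed [1/2]. *)
Lemma lam_gt0_near :
  exists2 e : R, 0 < e & forall r : R, 1 - e < r < 1 -> 0 < lam r.
Proof.
have [d /andP[d0 _] [e e0 H]] := oriented_gt beta_gt ltr01.
exists (Num.min e 1) => [|r /andP[]]; first by rewrite lt_min e0 ltr01.
rewrite ltrBlDr => r1 r2.
have [r1e r11] : 1 < r + e /\ 1 < r + 1.
  by split; apply: (lt_le_trans r1); rewrite lerD2l ge_min lexx ?orbT.
rewrite ltNge; apply/negP => l0.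
have : (G d r <= 0)%E.
  apply: oriented_le0; [apply: phi_fun; lra|apply: phi_ge0; lra|].
  by rewrite pmulr_rle0.
apply/negP; rewrite -ltNge.
by apply: lt_trans (H _ _); [rewrite lte_fin invr_gt0|lra].
Qed.

Lemma lam_small (e : R) : 0 < e ->
  exists2 s : R, 0 < s < 1 & forall r : R, s <= r <= 1 -> `|lam r| < e.
Proof.
move=> e0.
have /(continuous_within_itvP _ ltr01)[_ _ /cvgrPdist_lt /(_ _ e0)] := lam_cont.
move=> /at_left_itv[d d0 H].
(* Halving [d] puts every [r >= s] strictly inside the neighbourhood, and [1 / 2] keeps [s]
   positive. *)
exists (Num.max (1 - d / 2) (1 / 2)).
  by rewrite lt_max gt_max; apply/andP; split;
    [apply/orP; right|apply/andP; split]; lra.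
move=> r; rewrite ge_max => /andP[/andP[r1 r2]].
rewrite le_eqVlt => /orP[/eqP ->|r3]; first by rewrite lam1 normr0.
have := H r; rewrite lam1 sub0r normrN; apply; lra.
Qed.

(** The limsup supplies only some [d'] below [d], but once [lam r] is positive the integral grows
    with the radius, so [d] itself serves. The bound [d <= 1] keeps the interval within one
    period. *)
Lemma integral_concentration (a d : R) : (a%:E < beta)%E -> 0 < d -> d <= 1 ->
  exists2 s : R, 0 < s < 1 & forall r : R, s < r < 1 ->
    [/\ 0 < lam r, d * lam r < pi &
    (a%:E <
     \int[leb R]_(t in `[(- (d * lam r))%R, (d * lam r)%R]) (phi r t)%:E)%E].
Proof.
move=> ab d0 d1.
have [d' /andP[d'0 d'd] [e1 e10 H1]] := oriented_gt ab d0.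
have [e2 e20 H2] := lam_gt0_near.
have [s /andP[s0 s1] H3] := lam_small (@pi_gt0 R).
exists (Num.max s (1 - Num.min e1 e2)).
  rewrite lt_max s0 gt_max s1/=; have : 0 < Num.min e1 e2 by rewrite lt_min e10.
  lra.
move=> r /andP[]; rewrite gt_max ltrBlDr => /andP[sr r1] r2.
have [r1e r11] : 1 < r + e1 /\ 1 < r + e2.
  by split; apply: (lt_le_trans r1); rewrite lerD2l ge_min lexx ?orbT.
have l0 : 0 < lam r by apply: H2; lra.
have r0 : 0 < r < 1 by lra.
split => //.
  apply: (@le_lt_trans _ _ (lam r)); first by rewrite ler_piMl// ltW.
  by rewrite -[ltLHS]gtr0_norm//; apply: H3; lra.
apply: (@lt_le_trans _ _ (G d' r)); first by apply: H1; lra.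
have d'l : 0 < d' * lam r by rewrite mulr_gt0.
have dd' : d' * lam r <= d * lam r by rewrite ler_wpM2r// ltW.
rewrite /oriented_integral ifT; last by lra.
apply: ge0_subset_integral.
- exact: leb_itv_measurable.
- exact: leb_itv_measurable.
- by apply/measurable_EFinP; apply: measurable_funTS; exact: (phi_fun r0).1.
- by move=> t _; rewrite lee_fin; exact: phi_ge0.
- by move=> t /=; rewrite !in_itv/= => /andP[? ?]; lra.
Qed.

(** Otherwise an interval within one period would carry more than the total mass 1. This makes
    [beta] a real number. *)
Lemma beta_le1 : (beta <= 1)%E.
Proof.
rewrite leNgt; apply/negP => b1.
have [s /andP[s0 s1] H] := integral_concentration b1 ltr01 (lexx _).
have [|l0 lpi] := H ((s + 1) / 2); first by lra.
apply/negP; rewrite -leNgt -(@phi_int1 ((s + 1) / 2)); last by lra.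
apply: torus_integral_ge_itv => //; [apply: phi_fun|apply: phi_ge0]; lra.
Qed.
End kernel.

(** * Grid neighbourhoods *)

Definition grid {R : realType} (u eps : R) : set R :=
  \bigcup_(j in [set: int]) `[j%:~R * u - eps, j%:~R * u + eps]%classic.

(** Since [n u = 2 pi], a shift by the period shifts the index by [n]. *)
Lemma torus_measurable_grid (R : realType) (u eps : R) (n : nat) :
  n%:R * u = pi *+ 2 -> torus_measurable (grid u eps).
Proof.
move=> nu; split.
  apply: countable_bigcupT_measurable => // j; exact: leb_itv_measurable.
move=> x; rewrite -nu; split=> -[j _]; rewrite /= in_itv/= => /andP[jx xj].
  by exists (j - n%:Z)%R => //=; rewrite in_itv/= rmorphB/= mulrBl -pmulrn;
    apply/andP; split; lra.
by exists (j + n%:Z)%R => //=; rewrite in_itv/= rmorphD/= mulrDl -pmulrn;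
  apply/andP; split; lra.
Qed.

(** As [eps < u], only the indices from 0 to [n] can meet [[0, 2 pi[]; counting both ends gives the
    factor [n + 1]. *)
Lemma torus_measure_grid (R : realType) (u eps : R) (n : nat) :
  0 < u -> 0 <= eps < u -> n%:R * u = pi *+ 2 ->
  (torus_measure (grid u eps) <= (n.+1%:R * (eps *+ 2))%:E)%E.
Proof.
move=> u0 /andP[eps0 epsu] nu.
pose F (k : nat) : set (lebesgueR R) :=
  `[k%:R * u - eps, k%:R * u + eps]%classic.
apply: (@le_trans _ _ (\sum_(k < n.+1) leb R (F k))%E).
  apply: content_subadditive.
  - by move=> k _; exact: leb_itv_measurable.
  - apply: measurableI; last exact: measurable_torus_dom.
    exact: (torus_measurable_grid eps nu).1.
  move=> t [[j _]] /=; rewrite in_itv/= => /andP[jt tj].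
  rewrite /torus_dom /= in_itv/= -nu => /andP[t0 tn].
  have j0 : (0 <= j)%R.
    rewrite -ltzD1 -(ltr_int R) rmorphD/= -(@pmulr_lgt0 _ u)// mulrDl mul1r.
    lra.
  case: j j0 jt tj => // k _ kt tk.
  have kn : (k < n.+1)%N.
    rewrite -(ltr_nat R) -(ltr_pM2r u0) -natr1 mulrDl mul1r.
    have : (Posz k)%:~R * u - eps <= t by [].
    rewrite -pmulrn; lra.
  rewrite -bigcup_mkord; exists k => //; rewrite /F/= in_itv/=.
  by move: kt tk; rewrite -pmulrn => -> ->.
under eq_bigr => k _.
  rewrite leb_lebesgue lebesgue_measure_itv/= lte_fin.
  over.
rewrite (eq_bigr (fun _ => (eps *+ 2)%:E)).
  by rewrite sumEFin big_const_ord iter_addr addr0 mulr_natl.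
move=> k _; case: ifPn => [_|]; first by rewrite -EFinB; congr EFin; ring.
(* The interval degenerates only for [eps = 0]. *)
by rewrite -leNgt => H; congr EFin; lra.
Qed.

(** * One stage: a small set that raises the averages at every point *)

Section stage.
Context (R : realType) (phi : R -> R -> R) (lam : R -> R) (b : R).
Hypotheses
    (phi_fun : forall r : R, 0 < r < 1 -> torus_measurable_fun (phi r))
    (phi_ge0 : forall r : R, 0 < r < 1 -> forall t, 0 <= phi r t)
    (phi_equi : forall eps tau : R, 0 < eps -> 0 < tau < 1 ->
       exists2 delta : R, 0 < delta &
         forall (r : R) (e : set R), 0 < r < tau -> torus_measurable e ->
           (torus_measure e < delta%:E)%E ->
           (torus_integral e (phi r) < eps%:E)%E)
    (lam_cont : {within `[0, 1]%classic, continuous lam})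
    (lam1 : lam 1 = 0)
    (beta_def : b%:E = limf_esup (fun delta : R =>
       limf_einf (fun r : R =>
         oriented_integral (- (delta * lam r)) (delta * lam r) (phi r))
         1^'-) 0^'+)
    (beta_gt : ((2^-1)%:E < b%:E)%E).

Lemma lam_ivt (s w : R) : 0 < s < 1 -> 0 < w <= lam s ->
  exists2 r, s <= r <= 1 & lam r = w.
Proof.
move=> /andP[s0 s1] /andP[w0 wl].
have [|||r] := @IVT R lam s 1 w.
- exact: ltW.
- apply: continuous_subspaceW lam_cont => t /=.
  rewrite !in_itv/= => /andP[? ->].
  by rewrite andbT; lra.
- by rewrite lam1 ge_min le_max (ltW w0) wl orbT.
by rewrite in_itv/= => ? ?; exists r.
Qed.

(** The tolerance [d] depends neither on [x] nor on [N], because [N] will be the union of later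
    stages, chosen after [d]. With [E] left free, a stage can serve a set or its complement. One
    [eta] is lost to concentration, the other to [N]. *)
Lemma exists_stage_set (eta D : R) : 0 < eta -> 0 < D ->
  exists M d, [/\ torus_measurable M, (torus_measure M <= D%:E)%E, 0 < d &
    forall x, exists r, [/\ 0 < r < 1, 1 - eta < r &
      forall E N, torus_measurable E -> torus_measurable N ->
        (torus_measure N < d%:E)%E -> M `\` N `<=` E ->
        ((b - eta *+ 2)%:E <= Phi phi r (x + lam r) \1_E)%E]].
Proof.
move=> eta0 D0.
(* With [u = 2 pi / n], the grid set has measure at most
   [(n + 1) * 4 delta u <= 16 pi delta <= 64 delta]. *)
pose delta := Num.min (1 / 4) (D / 64) : R.
have delta0 : 0 < delta by rewrite lt_min; apply/andP; split; lra.
have delta4 : delta <= 1 / 4 by rewrite ge_min lexx.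
have deltaD : delta <= D / 64 by rewrite ge_min lexx orbT.
have beta_eta : ((b - eta)%:E < b%:E)%E by rewrite lte_fin; lra.
have [|s /andP[s0 s1] Hs] := integral_concentration phi_fun phi_ge0 lam_cont
  lam1 beta_def beta_gt beta_eta delta0.
  lra.
(* Every [r] in [[s', 1[] satisfies both the concentration bound and [1 - eta < r]. *)
pose s' := Num.max ((s + 1) / 2) (1 - eta / 2).
have ss' : s < s' by rewrite lt_max; apply/orP; left; lra.
have etas' : 1 - eta < s' by rewrite lt_max; apply/orP; right; lra.
have s'1 : s' < 1 by rewrite gt_max; apply/andP; split; lra.
have [|v0 _ _] := Hs s'; first by lra.
have pi0 := pi_gt0 R.
(* With this [n], [2 u <= lam s'], so [lam] takes every value in []0, 2 u]] on [[s', 1]]. *)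
pose n := (Num.truncn (pi *+ 4 / lam s')).+1.
have n0 : 0 < n%:R :> R by rewrite ltr0n.
pose u := pi *+ 2 / n%:R : R.
have nu : n%:R * u = pi *+ 2 by rewrite mulrC divfK// gt_eqF.
have u0 : 0 < u by rewrite divr_gt0// mulrn_wgt0.
have un : u *+ 2 <= lam s'.
  have := truncnS_gt (pi *+ 4 / lam s'); rewrite -/n ltr_pdivrMr// => /ltW H.
  by rewrite -(ler_pM2l n0) mulrnAr nu; lra.
have n1 : 1 <= n%:R :> R by rewrite ler1n.
have upi : u <= pi *+ 2 by rewrite -nu ler_peMl// ltW.
(* The [r] found below has [lam r > u], hence [r < t]; equi-integrability up to [t] therefore gives
   a [d] uniform in [x]. *)
have [t /andP[t0 t1] Ht] := lam_small lam_cont lam1 u0.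
have [|d d0 Hd] := phi_equi eta0 (tau := t); first by rewrite t0.
have eps0 : 0 < delta * (u *+ 2) by rewrite mulr_gt0// mulrn_wgt0.
have epsu : delta * (u *+ 2) <= u / 2.
  by rewrite mulrnAr -mulrnAl mulrC ler_pM2l//; lra.
exists (grid u (delta * (u *+ 2))), d; split => //.
- exact: torus_measurable_grid nu.
- apply: le_trans (torus_measure_grid u0 _ nu) _.
    by rewrite (ltW eps0)/=; lra.
  rewrite lee_fin -natr1 mulrDl mul1r.
  have -> : n%:R * ((delta * (u *+ 2)) *+ 2) = delta * (pi *+ 8).
    by rewrite -[pi *+ 8]/(pi *+ (2 * 4)) mulrnA -nu; ring.
  have pi4 : pi < 4 :> R by have /andP[_] := @pihalf_02 R; lra.
  have H1 : delta * (pi *+ 8) <= D / 64 * 32.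
    by apply: ler_pM => //; [exact: ltW| |]; lra.
  have H2 : delta * (u *+ 2) <= D / 64 * (pi *+ 4).
    by apply: ler_pM => //; [exact: ltW| |]; lra.
  have H3 : D / 64 * (pi *+ 4) <= D / 64 * 16 by rewrite ler_pM2l; lra.
  lra.
move=> x.
(* Adding 2 to the floor puts the grid point to the right of [x] at a distance in []u, 2 u]]. *)
pose j := (Num.floor (x / u) + 2)%R.
have /andP[] := floor_itv (x / u).
rewrite ler_pdivlMr// ltr_pdivrMr// rmorphD/= mulrDl mul1r => fl1 fl2.
have jE : j%:~R * u = (Num.floor (x / u))%:~R * u + u *+ 2.
  by rewrite rmorphD/= mulrDl; ring.
pose w := j%:~R * u - x.
have [w1 w2] : u < w /\ w <= u *+ 2 by rewrite /w jE; split; lra.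
have [||r /andP[s'r r1] lamr] := @lam_ivt s' w; [by lra|by lra|].
have rt : r < t.
  rewrite ltNge; apply/negP => tr.
  have := Ht r; rewrite tr r1 lamr => /(_ isT); rewrite gtr0_norm; lra.
have r01 : 0 < r < 1 by lra.
have [|l0 lpi Hi] := Hs r; first by lra.
exists r; split => //; first by lra.
move=> E N mE mN Nd MNE.
have cov y : x + lam r - delta * lam r <= y <= x + lam r + delta * lam r ->
    E y \/ N y.
  have dl : delta * lam r <= delta * (u *+ 2) by rewrite ler_pM2l// lamr.
  move=> /andP[y1 y2]; case: (pselect (N y)) => [Ny|nNy]; [by right|left].
  apply: MNE; split => //; exists j => //=; rewrite in_itv/=.
  have xl : x + lam r = j%:~R * u by rewrite lamr /w; ring.
  by rewrite xl in y1 y2; apply/andP; split; lra.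
have := Phi_lower (phi_fun r01) (phi_ge0 r01) mE mN lpi cov.
have := Hd r (fun s => N (x + lam r - s)).
rewrite torus_measure_reflect// => /(_ _ (torus_measurable_reflect _ mN) Nd).
move: Hi; set I := (X in (_ < X)%E).
set P := Phi _ _ _ _; set Q := torus_integral _ _.
move=> Hi /(_ _) Q1 IPQ.
have {}Q1 : (Q < eta%:E)%E by apply: Q1; lra.
have H : ((b - eta)%:E <= P + eta%:E)%E.
  by apply/(le_trans (ltW Hi))/(le_trans IPQ); rewrite leeD2l// ltW.
by rewrite mulr2n opprD addrA [(_ - _ - _)%:E]EFinB leeBlDr.
Qed.

End stage.

(** * Superposition of the stages *)

Lemma torus_measure_bigcup_geometric (R : realType) (F : nat -> set R) (a : R) :
  0 <= a -> (forall k, torus_measurable (F k)) ->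
  (forall k, (torus_measure (F k) <= (a / (2 ^ k.+1)%:R)%:E)%E) ->
  (torus_measure (\bigcup_k F k) <= a%:E)%E.
Proof.
move=> a0 mF Fa.
apply: le_trans (epsilon_trick0 xpredT a0).
apply: (@le_trans _ _ (\sum_(k <oo) torus_measure (F k))%E).
  apply: measure_sigma_subadditive.
  - move=> k; apply: measurableI; last exact: measurable_torus_dom.
    exact: (mF k).1.
  - apply: measurableI; last exact: measurable_torus_dom.
    exact: (torus_measurable_bigcup mF).1.
  - by rewrite setI_bigcupl.
by apply: lee_nneseries => k _ //; exact: measure_ge0.
Qed.

(** Here [D] is the measure allowed to a stage and [d] the tolerance it yields. The final bound sums
    over [i] to [d k / 2], so all stages after [k] together respect the tolerance of [k]. *)
Lemma geometric_selection (R : realType) (T : Type)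
    (P : nat -> R -> T -> R -> Prop) :
  (forall k D, 0 < D -> exists M d, 0 < d /\ P k D M d) ->
  exists (M : nat -> T) (D d : nat -> R),
    (forall k, [/\ 0 < D k, 0 < d k & P k (D k) (M k) (d k)]) /\
    (forall k i, D (k.+1 + i)%N <= d k / 2 / (2 ^ i.+1)%:R).
Proof.
move=> H.
have /choice[f Hf] : forall kD : nat * R, exists Md : T * R,
    0 < kD.2 -> 0 < Md.2 /\ P kD.1 kD.2 Md.1 Md.2.
  move=> [k D]; have [D0|D0] := ltP 0 D.
    by have [M [d Md]] := H k D D0; exists (M, d).
  (* For [D <= 0] any value will do; the one for [D = 1] is the default. *)
  have [M [d _]] := H k 1 ltr01.
  by exists (M, d).
(* The first later stage gets at most [d k / 4 = d k / 2 / 2]; the minimum with [D k'] makes each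
   further stage at most half of the previous one. *)
pose D := fix D k :=
  if k is k'.+1 then Num.min (D k') (f (k', D k')).2 / 4 else 1.
have D0 k : 0 < D k.
  elim: k => [|k IH] /=; first exact: ltr01.
  by rewrite divr_gt0// lt_min IH; have [] := Hf (k, D k) IH.
exists (fun k => (f (k, D k)).1), D, (fun k => (f (k, D k)).2); split.
  by move=> k; have [d0 Pk] := Hf (k, D k) (D0 k); split.
move=> k i; set d := (f (k, D k)).2.
elim: i => [|i IH].
  by rewrite addn0 expn1 -mulrA -invfM -natrM /= ler_pM2r// ge_min lexx orbT.
rewrite addnS /=.
have : Num.min (D (k.+1 + i)%N) (f ((k.+1 + i)%N, D (k.+1 + i)%N)).2 <=
    D (k.+1 + i)%N.
  by rewrite ge_min lexx.
have E2 : (2 ^ i.+2)%:R^-1 = (2 ^ i.+1)%:R^-1 / 2 :> R.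
  by rewrite expnSr natrM invfM.
rewrite E2 mulrA; have := D0 (k.+1 + i)%N.
set x := D _; set y := Num.min _ _; set z := d / 2 / _ in IH *.
rewrite -/x in IH.
by move=> ? ?; change (y / 4 <= z / 2); lra.
Qed.

(** * Alternation of the stages and oscillation at every point *)

Theorem theorem1p1 (R : realType) (phi : R -> R -> R) (lam : R -> R)
    (beta : \bar R)
    (phi_fun : forall r, 0 < r < 1 -> torus_measurable_fun (phi r))
    (phi_ge0 : forall r, 0 < r < 1 -> forall t, 0 <= phi r t)
    (phi_int1 : forall r, 0 < r < 1 -> torus_integral setT (phi r) = 1%E)
    (phi_equi : forall eps tau : R, 0 < eps -> 0 < tau < 1 ->
       exists2 delta : R, 0 < delta &
         forall (r : R) (e : set R), 0 < r < tau -> torus_measurable e ->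
           (torus_measure e < delta%:E)%E ->
           (torus_integral e (phi r) < eps%:E)%E)
    (lam_cont : {within `[0, 1]%classic, continuous lam})
    (lam1 : lam 1 = 0)
    (beta_def : beta = limf_esup (fun delta : R =>
       limf_einf (fun r : R =>
         oriented_integral (- (delta * lam r)) (delta * lam r) (phi r))
         1^'-) 0^'+)
    (beta_gt : ((2^-1)%:E < beta)%E) :
  exists2 E : set R, torus_measurable E &
    forall x : R,
      (2%:E * beta - 1 <=
         limf_esup (fun r : R => Phi phi r (x + lam r) \1_E) 1^'- -
         limf_einf (fun r : R => Phi phi r (x + lam r) \1_E) 1^'-)%E.
Proof.
have b1 := beta_le1 phi_fun phi_ge0 phi_int1 lam_cont lam1 beta_def beta_gt.
have bE : beta = (fine beta)%:E.
  rewrite fineK// fin_numE; apply/andP; split.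
    by rewrite gt_eqF// (lt_trans _ beta_gt)// ltNyr.
  by rewrite lt_eqF// (le_lt_trans b1)// ltry.
move: (fine beta) bE => b bE; rewrite {}bE in b1 beta_def beta_gt *.
pose eta (k : nat) : R := k.+1%:R^-1.
have eta0 k : 0 < eta k by rewrite invr_gt0.
have [|M [D [d [HM MD]]]] := @geometric_selection R (set R) (fun k D M d =>
    [/\ torus_measurable M, (torus_measure M <= D%:E)%E &
      forall x, exists r, [/\ 0 < r < 1, 1 - eta k < r &
        forall E N, torus_measurable E -> torus_measurable N ->
          (torus_measure N < d%:E)%E -> M `\` N `<=` E ->
          ((b - eta k *+ 2)%:E <= Phi phi r (x + lam r) \1_E)%E]]).
  move=> k D D0.
  have [M [d []]] := exists_stage_set phi_fun phi_ge0 phi_equi lam_cont lam1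
    beta_def beta_gt (eta0 k) D0.
  by exists M, d.
have mM k : torus_measurable (M k) by have [_ _ []] := HM k.
have dk0 k : 0 < d k by have [] := HM k.
(* Removing [N k] from [M k] leaves the points whose last stage is [k]. *)
pose N k := \bigcup_i M (k.+1 + i)%N.
have mN k : torus_measurable (N k) by exact: torus_measurable_bigcup.
have Nd k : (torus_measure (N k) < (d k)%:E)%E.
  apply: (@le_lt_trans _ _ (d k / 2)%:E); last first.
    by rewrite lte_fin ltr_pdivrMr// ltr_pMr// ltr1n.
  apply: torus_measure_bigcup_geometric => //.
    by rewrite divr_ge0// ltW.
  move=> i; have [_ _ [_ MDi _]] := HM (k.+1 + i)%N.
  by apply: le_trans MDi _; rewrite lee_fin.
pose E := \bigcup_m (M m.*2 `\` N m.*2).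
have mE : torus_measurable E.
  by apply: torus_measurable_bigcup => m; exact: torus_measurableD.
have ME m : M m.*2 `\` N m.*2 `<=` E by move=> t Mt; exists m.
have MEC m : M m.*2.+1 `\` N m.*2.+1 `<=` ~` E.
  move=> t [Mt nNt] [k _ [Mkt nNkt]].
  (* Two stages cannot both be last: the later of [2 k] and [2 m + 1] is part of the union removed
     from the earlier. *)
  have [mk|km] := ltnP m k.
    apply: nNt; exists (k.*2 - m.*2.+2)%N => //.
    by rewrite addnBA ?addKn// -doubleS leq_double.
  apply: nNkt; exists (m.*2 - k.*2)%N => //.
  by rewrite addSn subnKC// leq_double.
have small e : 0 < e -> exists m, eta m.*2 *+ 2 < e.
  (* For this [m], [2 eta (2 m) = 2 / (2 m + 1)] and [2 m + 1 >= m + 1 > 2 / e]. *)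
  move=> e0; exists (Num.truncn (2 / e)).
  have := truncnS_gt (2 / e); set n := Num.truncn _ => H.
  rewrite -mulr_natl ltr_pdivrMr// mulrC -ltr_pdivrMr//.
  by apply: lt_le_trans H _; rewrite ler_nat ltnS -addnn leq_addr.
have etaS k : eta k.+1 <= eta k by rewrite lef_pV2 ?posrE ?ltr0n// ler_nat.
exists E => // x.
have Phifin r E' : 0 < r < 1 -> torus_measurable E' ->
    Phi phi r (x + lam r) \1_E' \is a fin_num.
  move=> r01 mE'; rewrite ge0_fin_numE; last exact/Phi_ge0/phi_ge0.
  apply: (@le_lt_trans _ _ 1%E); last exact: ltry.
  rewrite -(phi_int1 r r01).
  rewrite -(Phi_compl (phi_fun r r01) (phi_ge0 r r01) (x + lam r) mE').
  by rewrite leeDl//; exact/Phi_ge0/phi_ge0.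
have sup_ge : (b%:E <=
    limf_esup (fun r : R => Phi phi r (x + lam r) \1_E) 1^'-)%E.
  apply: limf_esup_ge => e e0; have [m me] := small e e0.
  have [_ _ [_ _ /(_ x)[r [r01 r1 H]]]] := HM m.*2.
  exists r; first by have := eta0 m.*2; lra.
  apply: le_trans (H E (N m.*2) mE (mN _) (Nd _) (ME m)).
  by rewrite lee_fin; lra.
have inf_le : ((b - 1)%:E <=
    - limf_einf (fun r : R => Phi phi r (x + lam r) \1_E) 1^'-)%E.
  (* Minus the liminf is the limsup of [- Phi], and [- Phi] for [E] is [Phi] for the complement
     minus 1, which the odd stages bound from below. *)
  rewrite -limf_esupN; apply: limf_esup_ge => e e0; have [m me] := small e e0.
  have [_ _ [_ _ /(_ x)[r [r01 r1 H]]]] := HM m.*2.+1.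
  have e1 := etaS m.*2.
  exists r; first by have := eta0 m.*2; lra.
  have mEC := torus_measurableC mE.
  have := H _ (N m.*2.+1) mEC (mN _) (Nd _) (MEC m).
  have := Phi_compl (phi_fun r r01) (phi_ge0 r r01) (x + lam r) mE.
  rewrite (phi_int1 r r01).
  rewrite -(fineK (Phifin r E r01 mE)) -(fineK (Phifin r _ r01 mEC)).
  by rewrite -EFinD -EFinN !lee_fin => -[]; lra.
apply: le_trans (leeD sup_ge inf_le).
by rewrite -EFinM -EFinB -EFinD lee_fin; lra.
Qed.
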